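(* Let $k\geq 0$ be an integer and let $G$ be a graph of order $n\geq \max\{6k+11,\frac{(k+3)(k+4)}{2}\}$. If $$e(G)\geq \binom{n-k-1}{2}+\binom{k+2}{2},$$ then $G$ is weakly pancyclic with girth $3$. Furthermore, one of the following is true: (a) $G$ contains a cycle $C_{\ell}$ for each $\ell\in [3,n-k]$; (b) $G\cong L_{n,k+1}= K_1\vee(K_{n-k-2}+K_{k+1})$.
   Context: A graph is weakly pancyclic if it contains cycles of every length from its girth (length of a shortest cycle) to its circumference (length of a longest cycle). $+$ denotes disjoint union of graphs and $\vee$ denotes join (disjoint union plus all edges between the two parts). $e(G)$ is the number of edges. *)

(* Defs.v *)
From mathcomp Require Import all_boot.

Set Implicit Arguments.
Unset Strict Implicit.
Unset Printing Implicit Defensive.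

Record sgraph := SGraph {
  vertex :> finType;
  adj : rel vertex;
  adj_sym : symmetric adj;
  adj_irr : irreflexive adj }.

Definition edges (G : sgraph) : {set {set G}} :=
  [set [set p.1; p.2] | p : G * G & adj p.1 p.2].

(* The bound [2 < l] excludes the degenerate [ucycle]s of length 0 and 2. *)
Definition has_cycle (G : sgraph) (l : nat) : Prop :=
  2 < l /\ exists s : seq G, size s = l /\ ucycle (@adj G) s.

Definition is_girth (G : sgraph) (g : nat) : Prop :=
  has_cycle G g /\ forall l, has_cycle G l -> g <= l.

Definition is_circumference (G : sgraph) (c : nat) : Prop :=
  has_cycle G c /\ forall l, has_cycle G l -> l <= c.

(* An acyclic graph has neither a girth nor a circumference and is not counted
   as weakly pancyclic here. *)
Definition weakly_pancyclic (G : sgraph) : Prop :=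
  exists g c : nat, [/\ is_girth G g, is_circumference G c &
    forall l, g <= l <= c -> has_cycle G l].

Definition isomorphic (G H : sgraph) : Prop :=
  exists f : G -> H, bijective f /\ forall x y, adj (f x) (f y) = adj x y.

Definition complete_adj (n : nat) : rel 'I_n := fun x y => x != y.

Fact complete_sym n : symmetric (@complete_adj n).
Proof. by move=> x y; rewrite /complete_adj eq_sym. Qed.

Fact complete_irr n : irreflexive (@complete_adj n).
Proof. by move=> x; rewrite /complete_adj eqxx. Qed.

Definition complete (n : nat) : sgraph :=
  SGraph (@complete_sym n) (@complete_irr n).

(* [b] tells whether the two parts are completely joined or not joined at all. *)
Definition sum_adj (b : bool) (G H : sgraph) : rel (G + H)%type :=
  fun u v => match u, v with
             | inl x, inl y => adj x y
             | inr x, inr y => adj x y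
             | _, _ => b
             end.

Fact sum_sym b G H : symmetric (@sum_adj b G H).
Proof. by case=> x [] y //=; rewrite adj_sym. Qed.

Fact sum_irr b G H : irreflexive (@sum_adj b G H).
Proof. by case=> x /=; rewrite adj_irr. Qed.

Definition disjoint_union (G H : sgraph) : sgraph :=
  SGraph (@sum_sym false G H) (@sum_irr false G H).

Definition join (G H : sgraph) : sgraph :=
  SGraph (@sum_sym true G H) (@sum_irr true G H).

Definition Lgraph (n m : nat) : sgraph :=
  join (complete 1) (disjoint_union (complete (n - m - 1)) (complete m)).

(* Main.v *)
Require Import Defs.
From mathcomp Require Import all_boot zify.

Set Implicit Arguments.
Unset Strict Implicit.
Unset Printing Implicit Defensive.

(** With [t = k + 1], the hypothesis says that at most [t * (n - t - 1)] edges
    are missing. Repeatedly delete a vertex of degree at most [t]: this decreases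
    both [t] and [n] by one and preserves the bound. If the process reaches
    [t = 0], what remains is complete, and putting the vertices back one at a
    time yields either the extremal graph or a cycle longer than [n - t]. If it
    stops at a graph of minimum degree above [t], that graph is Hamiltonian by
    Erdős' theorem: two nonadjacent vertices of degree sum at least [n] may be
    joined (Ore), and otherwise a nonadjacent pair of maximal degree sum exhibits
    too many vertices of low degree. Finally, a longest cycle spans a subgraph
    with more than a quarter of the square of its order in edges, so by Bondy's
    argument on two consecutive vertices of large degree sum it is pancyclic. *)

(** * Chords of a cycle given as a sequence: Bondy's argument *)

Section Sequences.

Variables (T : eqType) (e : rel T).
Hypothesis e_sym : symmetric e.

Lemma sorted_clique (s : seq T) :
  uniq s -> {in s &, forall x y, x != y -> e x y} -> sorted e s.
Proof.
move=> Us Ks; apply: pairwise_sorted; move: Us; rewrite uniq_pairwise.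
apply: (sub_in_pairwise (P := mem s)); last exact/allP.
by move=> x y xs ys /=; exact: Ks.
Qed.

Lemma sorted_rev_sym (s : seq T) : sorted e (rev s) = sorted e s.
Proof. by rewrite rev_sorted; apply: eq_sorted => x y; rewrite e_sym. Qed.

(** The cycle follows the first path and returns along the second one reversed. This exchange serves
    both Bondy's and Ore's arguments. *)
Lemma crossing_cycle (x y z t : T) (s1 s2 : seq T) :
  path e x s1 -> last x s1 = y -> path e z s2 -> last z s2 = t ->
  e x z -> e y t -> cycle e (x :: s1 ++ rev (z :: s2)).
Proof.
move=> p1 l1 p2 l2 exz eyt; rewrite /= rcons_cat cat_path p1 l1 /=.
have -> : rcons (rev (z :: s2)) x = rev (x :: z :: s2).
  by rewrite [in RHS]rev_cons.
have : sorted e (rev (x :: z :: s2)) by rewrite sorted_rev_sym /= exz p2.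
by rewrite (lastI x (z :: s2)) rev_rcons /= l2 eyt.
Qed.

Lemma pigeonhole_nth (x0 : T) (a b : pred T) (p q : seq T) :
  size p = size q -> size p < count a p + count b q ->
  exists2 i, i < size p & a (nth x0 p i) && b (nth x0 q i).
Proof.
elim: p q => [|x p IH] [|y q] //= [sz] lt.
have [ab|nab] := boolP (a x && b y); first by exists 0.
have [||i ip abi] := IH q => //; last by exists i.+1.
by case: (a x) (b y) nab lt => [] [] //= _; lia.
Qed.

Lemma split_segment (x0 : T) (p : seq T) (m r : nat) :
  m + r < size p ->
  exists p1 a q p2, [/\ p = p1 ++ a :: q ++ p2, size p1 = m, size q = r,
    a = nth x0 p m & last a q = nth x0 p (m + r)].
Proof.
move=> mr; exists (take m p), (nth x0 p m), (take r (drop m.+1 p)).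
exists (drop r (drop m.+1 p)); split=> //.
- by rewrite cat_take_drop -drop_nth ?cat_take_drop //; lia.
- by rewrite size_takel //; lia.
- by rewrite size_takel // size_drop; lia.
- case: r mr => [|r] mr; first by rewrite take0 addn0.
  rewrite (last_nth x0) size_takel ?size_drop; last lia.
  by rewrite /= nth_take // nth_drop; congr nth; lia.
Qed.

(** Match each [p_i] with a cyclically shifted vertex of [p] so that a chord from [y] to [p_i] and
    one from [x] to its match close a cycle of length [l]. With more than [size p] chords, some
    matched pair receives both. *)
Lemma bondy_ends (x y : T) (p : seq T) (l : nat) :
  cycle e (x :: rcons p y) -> uniq (x :: rcons p y) ->
  2 < l <= (size p).+2 -> size p < count (e y) p + count (e x) p ->
  exists s, [/\ size s = l, cycle e s & uniq s].
Proof.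
move=> Cyc U /andP[l2 lp] cnt.
move: Cyc; rewrite /= rcons_path last_rcons => /andP[pth exy].
(* [rot k p] matches [p_i] with [p_(i + k)], or with [p_(i - (l - 3))] after the wrap. *)
have [k Ek] : {k | k = size p - (l - 3)} by exists (size p - (l - 3)).
have [||i ip /andP[yi xi]] := @pigeonhole_nth x (e y) (e x) p (rot k p).
- by rewrite size_rot.
- suff -> : count (e x) (rot k p) = count (e x) p by [].
  by apply/permP; rewrite perm_rot.
move: xi; rewrite /rot nth_cat size_drop.
case: ltnP => hi xi.
(* No wrap: go from [x] to [p_i], jump to [y], come back down to [p_(i + k)] and return to [x]. Only
   the [k - 1] vertices in between are skipped, which leaves [l]. *)
- move: xi; rewrite nth_drop addnC => xi.
  have [|p1 [a [q [p2 [Ep s1 sq Ea Eb]]]]] := @split_segment x p i k; first lia.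
  move: yi xi; rewrite -Ea -Eb; case/lastP: q sq Ep {Ea Eb} => [|q b].
    by rewrite /=; lia.
  rewrite last_rcons cat_rcons => sq Ep ya xb.
  have := congr1 size Ep; rewrite !size_cat /= size_cat => sz.
  rewrite size_rcons in sq.
  exists (x :: rcons p1 a ++ rev (b :: rcons p2 y)); split.
  + by rewrite /= size_cat size_rev /= !size_rcons; move: sz; rewrite /=; lia.
  + move: pth; rewrite Ep !(rcons_cat, rcons_cons) -cat_rcons cat_path /= cat_path /=.
    case/and4P=> P1 _ _ P2.
    apply: (@crossing_cycle _ a _ y) => //; rewrite ?last_cat ?last_rcons //.
    by rewrite e_sym.
  + have perm_s : perm_eq (x :: rcons p1 a ++ rev (b :: rcons p2 y))
        (x :: rcons p1 a ++ b :: rcons p2 y).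
      by rewrite perm_cons perm_cat2l perm_rev.
    rewrite (perm_uniq perm_s); apply: (subseq_uniq _ U).
    rewrite Ep !(rcons_cat, rcons_cons) -[p1 ++ _]cat_rcons /= eqxx.
    by rewrite cat_subseq // suffix_subseq.
(* After the wrap: the segment from [p_m] to [p_i] has [l - 2] vertices and is closed through [y]
   and [x]. *)
- have [m Em] : {m | i = m + (l - 3)} by exists (i - (l - 3)); lia.
  move: xi; rewrite nth_take; last lia.
  have -> : i - (size p - k) = m by lia.
  move=> xi; subst i.
  have [|p1 [b [q [p2 [Ep s1 sq Eb Ea]]]]] := @split_segment x p m (l - 3); first lia.
  move: yi xi; rewrite -Ea -Eb => ya xb.
  exists (x :: b :: rcons q y); split.
  + by rewrite /= size_rcons; lia.
  + move: pth; rewrite Ep !(rcons_cat, rcons_cons) cat_path /= cat_path.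
    case/and4P=> _ _ P1 _.
    by rewrite /= xb !rcons_path last_rcons P1 exy e_sym ya.
  + apply: (subseq_uniq _ U).
    rewrite Ep !(rcons_cat, rcons_cons) /= eqxx -rcons_cons -cats1 -cat_cons.
    apply: subseq_trans (suffix_subseq p1 _).
    by rewrite cat_subseq // sub1seq mem_rcons mem_head.
Qed.

(** If all consecutive vertices had degree sum at most [size s], summing around the cycle would
    contradict the bound on the total. So some consecutive pair is heavy, and [bondy_ends] applies
    to it. *)
Lemma bondy_pancyclic (s : seq T) (l : nat) :
  irreflexive e ->
  ucycle e s -> size s * size s < 2 * \sum_(x <- s) count (e x) s ->
  2 < l <= size s -> exists s', size s' = l /\ ucycle e s'.
Proof.
move=> e_irr /andP[Cs Us] lt_s /andP[l2 ls].
pose d x := count (e x) s.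
pose r := [rel x y | d x + d y <= size s].
(* Along a path, inner degrees count twice and end degrees once; the last degree stands on the right
   to avoid subtraction. *)
have sum_path x q : path r x q ->
    d x + 2 * (\sum_(y <- q) d y) <= d (last x q) + size q * size s.
  elim: q x => [|y q IH] x /=; first by rewrite big_nil; lia.
  by rewrite big_cons => /andP[rxy /IH]; lia.
have /negP nr : ~ cycle r s.
  case Es : {1}s => [|x p]; first by move: lt_s; rewrite Es big_nil.
  move=> /sum_path; rewrite last_rcons size_rcons -cats1 big_cat big_cons big_nil.
  have -> : (size p).+1 = size s by rewrite Es.
  have : \sum_(z <- s) d z = d x + \sum_(z <- p) d z by rewrite {1}Es big_cons.
  rewrite /= => sum_s; move: lt_s.
  by rewrite -[\sum_(x <- s) _]/(\sum_(z <- s) d z); lia.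
have [x xs nrx] : exists2 x, x \in s & ~~ r x (next s x).
  apply/hasP; apply: contraNT nr => /hasPn nr.
  by apply: cycle_from_next Us _ => x /nr; rewrite negbK.
have [i p Ep] := rot_to xs.
move: nrx; rewrite -(next_rot i) // Ep.
case: p Ep => [|y p] Ep /=.
  have := size_rot i s; rewrite Ep /=; lia.
rewrite eqxx -ltnNge => lt_d.
(* One more rotation puts the heavy pair at the two ends. Each loses at most one neighbour, the
   other end, so more than [size p] chords into [p] remain. *)
have E : rot 1 (rot i s) = y :: rcons p x by rewrite Ep rot1_cons.
have Cr : cycle e (y :: rcons p x) by rewrite -E !rot_cycle.
have Ur : uniq (y :: rcons p x) by rewrite -E !rot_uniq.
have perm_s : perm_eq s (y :: rcons p x) by rewrite -E perm_sym !perm_rot.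
have sz : size s = (size p).+2 by rewrite (perm_size perm_s) /= size_rcons.
have [||s' [<- Cs' Us']] := bondy_ends Cr Ur (l := l).
- by rewrite l2 -sz.
- move: lt_d; rewrite /d !(permP perm_s) /= -cats1 !count_cat /= !e_irr.
  rewrite !addn0 sz.
  by case: (e x y) (e y x) => [] []; lia.
- by exists s'; rewrite /ucycle /ucycleb Cs' Us'.
Qed.

End Sequences.

(** * Counting missing edges, and Ore's closure step *)

Section Degrees.

Variable V : finType.
Implicit Types (e : rel V) (A W : {set V}) (u v x y : V).

Definition deg e A x := #|[set y in A | e x y]|.

Definition codeg e A x := #|[set y in A | (y != x) && ~~ e x y]|.

(* Twice the number of edges missing from the subgraph induced by [A]. *)
Definition defect e A := \sum_(x in A) codeg e A x.

Definition hamiltonian e A :=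
  exists s, [/\ ucycle e s, {subset s <= A} & size s = #|A|].

Lemma deg_codeg e A x :
  irreflexive e -> x \in A -> (deg e A x + codeg e A x).+1 = #|A|.
Proof.
move=> e_irr xA; rewrite (cardsD1 x A) xA add1n; congr S.
rewrite -(cardsID [set y | e x y] (A :\ x)); congr (_ + _); apply: eq_card => y;
  rewrite !inE; case: eqP => [->|_] //=; rewrite ?e_irr ?andbF //.
by rewrite andbC.
Qed.

Lemma codeg_setD1 e A v x : v \in A -> x != v ->
  codeg e A x = codeg e (A :\ v) x + ~~ e x v.
Proof.
move=> vA xv; rewrite /codeg (cardsD1 v) !inE vA eq_sym xv /= addnC; congr (_ + _).
by apply: eq_card => y; rewrite !inE andbA.
Qed.

Lemma sum_nat_bool (P Q : pred V) : \sum_(x | P x) Q x = #|[set x | P x && Q x]|.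
Proof. by rewrite -sum1dep_card big_mkcondr; apply: eq_bigr => x _; case: (Q x). Qed.

Lemma defect_setD1 e A v : symmetric e -> v \in A ->
  defect e A = defect e (A :\ v) + 2 * codeg e A v.
Proof.
move=> e_sym vA; rewrite /defect (big_setD1 v) //=.
rewrite (eq_bigr (fun x => codeg e (A :\ v) x + ~~ e x v)); last first.
  by move=> x; rewrite !inE => /andP[xv _]; apply: codeg_setD1.
rewrite big_split /= (sum_nat_bool _ (fun x => ~~ e x v)).
suff -> : #|[set x | (x \in A :\ v) && ~~ e x v]| = codeg e A v by lia.
by apply: eq_card => x; rewrite !inE e_sym andbA [(x \in A) && _]andbC.
Qed.

Lemma defect_sub e A W : W \subset A -> defect e W <= defect e A.
Proof.
move=> WA; rewrite /defect [leqRHS](big_setID W) /= (setIidPr WA).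
apply: leq_trans (leq_addr _ _); apply: leq_sum => x _; apply: subset_leq_card.
by apply/subsetP=> y; rewrite !inE => /andP[/(subsetP WA) ->].
Qed.

(** Each vertex of [W] lies in [c] missing pairs, and only pairs inside [W] are met from both ends.
    The induction removes the vertices of [W] one by one, each removal costing the others at most
    one missing pair. *)
Lemma defect_low_degree e A W c : symmetric e -> W \subset A ->
  {in W, forall x, c <= codeg e A x} ->
  2 * (#|W| * c) <= defect e A + #|W| * #|W|.-1.
Proof.
move=> e_sym; move Ei : #|W| => i; elim: i A W c Ei => [|i IH] A W c Ei WA cW //.
have [v vW] : exists v, v \in W by apply/set0Pn; rewrite -card_gt0 Ei.
have vA := subsetP WA v vW.
have le_i : 2 * (i * c.-1) <= defect e (A :\ v) + i * i.-1.
  apply: (IH _ (W :\ v)).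
  - by have := cardsD1 v W; rewrite vW Ei; lia.
  - exact: setSD.
  - move=> x; rewrite !inE => /andP[xv xW].
    by have := cW x xW; rewrite (codeg_setD1 e vA xv); case: (e x v) => /=; lia.
rewrite (defect_setD1 e_sym vA); have := cW v vW.
move: le_i; case: c {IH cW} => [|c] /=; first lia.
by case: i {Ei} => [|i] /=; lia.
Qed.

Lemma count_deg e A s x : uniq s -> s =i A -> count (e x) s = deg e A x.
Proof.
move=> Us sA; rewrite -size_filter /deg -(card_uniqP (filter_uniq _ Us)).
by apply: eq_card => y; rewrite !inE mem_filter sA andbC.
Qed.

Lemma hamiltonian_mem e A s :
  ucycle e s -> {subset s <= A} -> size s = #|A| -> s =i A.
Proof.
move=> /andP[_ Us] sA sz x; rewrite -(mem_enum A).
have [||_ ->//] := uniq_min_size Us (s2 := enum A).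
- by move=> y ys; rewrite mem_enum sA.
- by rewrite -cardE sz.
Qed.

Definition add_edge e u v : rel V :=
  fun x y => [|| e x y, (x == u) && (y == v) | (x == v) && (y == u)].

Lemma add_edge_sym e u v : symmetric e -> symmetric (add_edge e u v).
Proof.
move=> e_sym x y; rewrite /add_edge e_sym; congr (_ || _).
by rewrite orbC ![(_ == u) && _]andbC.
Qed.

Lemma add_edge_irr e u v : irreflexive e -> u != v -> irreflexive (add_edge e u v).
Proof.
move=> e_irr uv x; rewrite /add_edge e_irr /=; case: (eqVneq x u) => [->|] /=.
  by rewrite (negPf uv).
by rewrite andbF.
Qed.

Lemma deg_add_edge e A u v x : deg e A x <= deg (add_edge e u v) A x.
Proof.
apply: subset_leq_card; apply/subsetP=> y; rewrite !inE => /andP[-> exy].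
by rewrite /add_edge exy.
Qed.

Lemma defect_add_edge e A u v : u \in A -> v \in A -> u != v -> ~~ e u v ->
  defect (add_edge e u v) A < defect e A.
Proof.
move=> uA vA uv nuv; rewrite /defect (bigD1 u) //= [ltnRHS](bigD1 u) //=.
have le_x x : codeg (add_edge e u v) A x <= codeg e A x.
  apply: subset_leq_card; apply/subsetP=> y; rewrite !inE => /and3P[-> -> /=].
  by rewrite /add_edge; case: (e x y).
rewrite -addSn; apply: leq_add; last by apply: leq_sum.
apply: proper_card; apply/properP; split.
  apply/subsetP=> y; rewrite !inE => /and3P[-> -> /=].
  by rewrite /add_edge; case: (e u y).
by exists v; rewrite !inE vA eq_sym uv ?nuv //= /add_edge !eqxx orbT.
Qed.

(** Align each vertex of [p] with its predecessor on the path. By counting, some consecutive [a],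
    [b] have [a] adjacent to the last vertex and [b] adjacent to [u]; exchanging the edge [ab] for
    these two closes the path. *)
Lemma ore_path e u p : symmetric e -> irreflexive e ->
  path e u p -> uniq (u :: p) ->
  size (u :: p) <= count (e u) (u :: p) + count (e (last u p)) (u :: p) ->
  exists s, ucycle e s /\ perm_eq s (u :: p).
Proof.
move=> e_sym e_irr Pp Up le_p.
set v := last u p.
have [||i ip /andP[vi ui]] := @pigeonhole_nth _ u (e v) (e u) (belast u p) p.
- by rewrite size_belast.
- move: le_p; rewrite [count (e (last _ _)) _](_ : _ = count (e v) (belast u p)).
    by rewrite size_belast /= e_irr; lia.
  by rewrite lastI -cats1 count_cat /= -/v e_irr !addn0.
rewrite size_belast in ip.
have Ep : p = take i p ++ nth u p i :: drop i.+1 p.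
  by rewrite -drop_nth // cat_take_drop.
have Elast : nth u (belast u p) i = last u (take i p).
  have -> : nth u (belast u p) i = nth u (u :: p) i.
    by rewrite [u :: p]lastI nth_rcons size_belast ip.
  by rewrite (last_nth u) size_takel 1?ltnW //; case: (i) => //= j; rewrite nth_take.
move: Pp; rewrite Ep cat_path /= => /and3P[P1 _ P2].
have Ev : last (nth u p i) (drop i.+1 p) = v by rewrite /v {3}Ep last_cat.
exists (u :: take i p ++ rev (nth u p i :: drop i.+1 p)).
have perm_s : perm_eq (u :: take i p ++ rev (nth u p i :: drop i.+1 p)) (u :: p).
  by rewrite {4}Ep perm_cons perm_cat2l perm_rev.
split; last by rewrite -Ep.
rewrite /ucycle /ucycleb (perm_uniq perm_s) Up andbT.
apply: (crossing_cycle e_sym P1 (erefl _) P2 Ev ui).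
by rewrite -Elast e_sym.
Qed.

(** If the cycle uses the added edge, removing that edge leaves a spanning path from [u] to [v], to
    which [ore_path] applies; otherwise it is already a cycle of [e]. *)
Lemma ore_step e A u v : symmetric e -> irreflexive e ->
  u != v -> 2 < #|A| -> u \in A -> v \in A ->
  #|A| <= deg e A u + deg e A v ->
  hamiltonian (add_edge e u v) A -> hamiltonian e A.
Proof.
move=> e_sym e_irr uv A2 uA vA le_A [s [Cs sA sz]].
have sEA := hamiltonian_mem Cs sA sz.
case/andP: Cs => Cs Us.
suff [s' [Cs' perm_s]] : exists s', ucycle e s' /\ perm_eq s' s.
  exists s'; split; rewrite ?(perm_size perm_s) //.
  by move=> x; rewrite (perm_mem perm_s) => /sA.
have us : u \in s by rewrite sEA.
have [i p Ep] := rot_to us.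
have perm_p : perm_eq (u :: p) s by rewrite -Ep perm_rot.
have Up : uniq (u :: p) by rewrite (perm_uniq perm_p).
have Cp : cycle (add_edge e u v) (u :: p) by rewrite -Ep rot_cycle.
have ore_end q : perm_eq (u :: q) s -> path e u q -> last u q = v ->
    exists s', ucycle e s' /\ perm_eq s' s.
  move=> perm_q Pq Eq.
  have Uq : uniq (u :: q) by rewrite (perm_uniq perm_q).
  have szq : size (u :: q) = #|A| by rewrite (perm_size perm_q).
  have qA : u :: q =i A by move=> x; rewrite (perm_mem perm_q).
  have [|s' [Cs' perm_s]] := ore_path e_sym e_irr Pq Uq.
  - by rewrite Eq !(count_deg _ _ Uq qA) szq.
  - by exists s'; split=> //; apply: perm_trans perm_s perm_q.
have szp : size (u :: p) = #|A| by rewrite (perm_size perm_p).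
case/lastP: p => [|p y] in Ep perm_p Up Cp szp *; first by move: szp => /=; lia.
case: p => [|x p] in Ep perm_p Up Cp szp *; first by move: szp => /=; lia.
have upath q : u \notin q -> sorted (add_edge e u v) q -> sorted e q.
  move=> uq; apply: (sub_in_sorted (P := mem q)); last exact/allP.
  move=> a b aq bq; rewrite /add_edge.
  by rewrite (negPf (memPn uq a aq)) (negPf (memPn uq b bq)) /= andbF orbF.
have [Nu Uq] := andP Up.
have Pin : path e x (rcons p y).
  apply: (upath (x :: rcons p y)) => //=.
  by move: Cp; rewrite /= rcons_path => /and3P[].
have [exu eyu] : add_edge e u v u x /\ add_edge e u v y u.
  by move: Cp; rewrite /= rcons_path last_rcons => /and3P[].
have [xu yu] : x != u /\ y != u.
  by move: Nu; rewrite !(inE, mem_rcons) !negb_or ![u == _]eq_sym => /and3P[].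
have xy : x != y.
  by move: Uq; rewrite /= mem_rcons inE negb_or => /andP[/andP[]].
move: exu eyu; rewrite /add_edge !eqxx (negPf xu) (negPf yu) (negPf uv) /=.
rewrite ?andbF ?andbT ?orbF.
(* [x] and [y] are the two cycle neighbours of [u], so the added edge is used exactly when one of
   them is [v]. *)
case: (eqVneq x v) => [xv|xv]; rewrite ?orbF.
  move=> _; rewrite -xv eq_sym (negPf xy) orbF => eyu.
  apply: (ore_end (rev (x :: rcons p y))).
  - by apply: perm_trans perm_p; rewrite perm_cons perm_rev.
  - have : sorted e (rev (x :: rcons p y)) by rewrite sorted_rev_sym.
    by rewrite -rcons_cons rev_rcons /= e_sym eyu.
  - by rewrite rev_cons last_rcons.
move=> exu; case: (eqVneq y v) => [yv|yv]; rewrite ?orbF => eyu.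
  apply: (ore_end (x :: rcons p y)) => //=; first by rewrite exu.
  by rewrite last_rcons.
exists (u :: x :: rcons p y); split=> //.
by rewrite /ucycle /ucycleb Up andbT /= exu rcons_path Pin last_rcons.
Qed.

End Degrees.

(* [j * (2 * (n - 1 - i) + 1 - j)] grows with [j] and is at least
   [(t + 1) * (2 * n - 4 - 3 * t)] at [j = i], by concavity in [i]. *)
Lemma erdos_arith (n t i j D : nat) :
  6 * t + 5 <= n -> (t + 2) * (t + 3) <= 2 * n -> t < i -> 2 * i < n -> i <= j ->
  i + j < n -> 2 * (j * (n - i.+1)) <= D + j * j.-1 -> 2 * (t * (n - t.+1)) < D.
Proof.
move=> n6 nt ti in2 ij ijn lb.
have [a Ea] : {a | i = t.+1 + a} by exists (i - t.+1); lia.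
have [b Eb] : {b | n = 6 * t + 5 + b} by exists (n - (6 * t + 5)); lia.
have [c Ec] : {c | n = 2 * i + 1 + c} by exists (n - (2 * i + 1)); lia.
have [d Ed] : {d | j = i + d} by exists (j - i); lia.
have [f Ef] : {f | n = i + j + 1 + f} by exists (n - (i + j + 1)); lia.
have En : n - i.+1 = j + f by lia.
have Et : n - t.+1 = 5 * t + 4 + b by lia.
have [j' Ej'] : {j' | j = j'.+1} by exists j.-1; lia.
have lb1 : j * j + j + 2 * (j * f) <= D.
  by move: lb; rewrite En Ej' /=; lia.
(* The bound at [j = i]. *)
have lb2 : i * (2 * n) <= D + i + 3 * (i * i).
  have -> : 2 * n = 2 * i + 2 * j + 2 + 2 * f by lia.
  by rewrite Ed in lb1 *; lia.
(* The expansion of [(i - (t + 1)) * (n - 2 * i - 1) >= 0], which encodes the concavity. *)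
have ac : 2 * (i * i) + t.+1 * n + i <= i * n + 2 * (t.+1 * i) + t.+1.
  by rewrite Ec Ea; lia.
(* At [i = t + 1] the bound exceeds the target by [2 * n - (t + 1) * (t + 4)], positive by [nt]. The
   other end, [2 * i = n - 1], gives no less because [n >= 6 * t + 5]. *)
rewrite Et; move: nt ac lb2; rewrite Ea Eb.
by clear; lia.
Qed.

(** * Erdős' theorem and the induction by vertex deletion *)

Section LongCycle.

Variable V : finType.
Implicit Types (e : rel V) (A C : {set V}) (u v w x y : V).

Lemma clique_cycle e (s : seq V) :
  uniq s -> 1 < size s -> {in s &, forall x y, x != y -> e x y} -> cycle e s.
Proof.
move=> Us s1 Ks; have := sorted_clique Us Ks.
case/lastP: s => [|s y] // in Us s1 Ks *.
case: s => [|x s] // in Us s1 Ks *.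
rewrite /= (rcons_path e x (rcons s y)) last_rcons => ->.
apply: Ks; rewrite ?(mem_head, mem_rcons, inE) ?eqxx ?orbT //.
by apply: contraTneq Us => ->; rewrite /= mem_rcons mem_head.
Qed.

Lemma defect_eq0 e A : defect e A = 0 -> {in A &, forall x y, x != y -> e x y}.
Proof.
move=> /eqP; rewrite sum_nat_eq0 => /forall_inP D0 x y xA yA xy.
have := D0 x xA; rewrite cards_eq0 => /eqP/setP/(_ y).
by rewrite !inE yA eq_sym xy /=; case: (e x y).
Qed.

(** Induction on the defect: each edge added by Ore's step lowers it, and a clique is Hamiltonian at
    once. *)
Lemma erdos_hamiltonian e A t : symmetric e -> irreflexive e ->
  6 * t + 5 <= #|A| -> (t + 2) * (t + 3) <= 2 * #|A| ->
  {in A, forall x, t < deg e A x} -> defect e A <= 2 * (t * (#|A| - t.+1)) ->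
  hamiltonian e A.
Proof.
have [N] := ubnP (defect e A); elim: N e => // N IH e ltN e_sym e_irr n6 nt degA defA.
pose P (p : V * V) := [&& p.1 \in A, p.2 \in A, p.1 != p.2 & ~~ e p.1 p.2].
have [[u0 v0] P0|noP] := pickP P; last first.
  exists (enum A); split; [|by move=> x; rewrite mem_enum|by rewrite -cardE].
  rewrite /ucycle /ucycleb enum_uniq andbT.
  apply: clique_cycle => //; [exact: enum_uniq|by rewrite -cardE; lia|].
  move=> x y; rewrite !mem_enum => xA yA xy.
  by have := noP (x, y); rewrite /P /= xA yA xy /= => /negbFE.
pose d (p : V * V) := deg e A p.1 + deg e A p.2.
have [u [v [Puv max_uv le_uv]]] : exists u v, [/\ P (u, v),
    forall x y, P (x, y) -> deg e A x + deg e A y <= deg e A u + deg e A v &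
    deg e A u <= deg e A v].
  case: (@arg_maxnP _ (u0, v0) P d P0) => -[u v] Puv max_uv.
  have [le_uv|lt_vu] := leqP (deg e A u) (deg e A v).
    by exists u, v; split=> // x y /max_uv.
  exists v, u; split=> [|x y /max_uv|]; last exact: ltnW.
    by case/and4P: Puv => *; apply/and4P; rewrite /= eq_sym e_sym.
  by rewrite /d /= => /leq_trans; apply; rewrite addnC.
have /and4P[/= uA vA uv nuv] := Puv.
have [leA|ltA] := leqP #|A| (deg e A u + deg e A v).
  apply: (ore_step e_sym e_irr uv _ uA vA leA); first lia.
  have lt_def := defect_add_edge uA vA uv nuv.
  apply: IH => //.
  - exact: leq_trans lt_def _.
  - exact: add_edge_sym.
  - exact: add_edge_irr.
  - by move=> x xA; apply: leq_trans (degA x xA) (deg_add_edge _ _ _ _ _).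
  - exact: leq_trans (ltnW lt_def) defA.
(* With [i = deg e A u], maximality bounds the degrees in [W] by [i]. The order [j] of [W] is
   [#|A| - 1 - deg e A v], hence at least [i], and [erdos_arith] contradicts the defect bound. *)
pose W := [set w in A | (w != v) && ~~ e v w].
have WA : W \subset A by apply/subsetP=> w; rewrite inE => /andP[].
have cW : {in W, forall w, #|A| - (deg e A u).+1 <= codeg e A w}.
  move=> w; rewrite inE => /and3P[wA wv nvw].
  have := deg_codeg e_irr wA.
  have : P (w, v) by rewrite /P /= wA vA wv e_sym.
  by move=> /max_uv; clear - ltA; lia.
have := defect_low_degree e_sym WA cW; have := deg_codeg e_irr vA.
rewrite -[codeg e A v]/(#|W|) => EW lb.
suff : 2 * (t * (#|A| - t.+1)) < defect e A by rewrite ltnNge defA.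
by apply: (erdos_arith n6 nt (degA u uA) _ _ _ lb); lia.
Qed.

(* The cliques [A :\: C] and [u |: C] share only the cut vertex [u]. *)
Definition two_cliques e A u C := [/\ u \in A, C \subset A, u \notin C &
  {in A &, forall x y, x != y -> e x y =
     ((x \notin C) && (y \notin C)) || ((x \in u |: C) && (y \in u |: C))}].

(** All pairs between [C] and [A :\: (u |: C)] are missing, and each is counted from both sides. *)
Lemma two_cliques_defect e A u C : symmetric e -> two_cliques e A u C ->
  2 * (#|C| * (#|A| - #|C|.+1)) <= defect e A.
Proof.
move=> e_sym [uA CA uC eE].
have : 2 * (#|C| * (#|A| - #|C|.+1)) =
  \sum_(x in C) (#|A| - #|C|.+1) + \sum_(x in A :\: (u |: C)) #|C|.
  rewrite !sum_nat_const.
  have -> : #|A :\: (u |: C)| = #|A| - #|C|.+1.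
    rewrite cardsD (setIidPr _) ?cardsU1 ?uC //.
    by rewrite subUset sub1set uA.
  by lia.
move=> ->; rewrite /defect [leqRHS](big_setID (u |: C)) /=.
have uCA : u |: C \subset A by rewrite subUset sub1set uA.
rewrite (setIidPr uCA) (big_setU1 u) //= -addnA; apply: leq_trans (leq_addl _ _).
apply: leq_add; apply: leq_sum => x.
  move=> xC; have xA := subsetP CA x xC.
  have -> : #|A| - #|C|.+1 = #|A :\: (u |: C)|.
    by rewrite cardsD (setIidPr uCA) ?cardsU1 ?uC.
  apply: subset_leq_card; apply/subsetP=> y.
  rewrite !inE negb_or -andbA => /and3P[yu yC yA].
  have yx : x != y by apply: contraNneq yC => <-.
  by rewrite yA eq_sym yx eE // !inE xC (negPf yu) (negPf yC) /= andbF.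
rewrite !inE negb_or -andbA => /and3P[xu xC xA]; apply: subset_leq_card.
apply/subsetP=> y yC; rewrite inE (subsetP CA y yC) /=.
have yx : y != x by apply: contraNneq xC => <-.
by rewrite yx eE ?(subsetP CA y yC) 1?eq_sym // !inE yC (negPf xu) (negPf xC).
Qed.

(** The cycle crosses the clique from [a] to [b] through all its vertices, then returns along the
    ear [p]. *)
Lemma clique_path_cycle e (K : {set V}) (p : seq V) a b :
  {in K &, forall x y, x != y -> e x y} -> a \in K -> b \in K -> a != b ->
  uniq p -> {in p, forall x, x \notin K} -> path e b (rcons p a) ->
  exists s, [/\ ucycle e s, {subset s <= p ++ enum K} & size s = #|K| + size p].
Proof.
move=> Kc aK bK ab Up pK bpa.
pose q := rcons (enum (K :\ a :\ b)) b.
have qE : perm_eq (a :: q) (enum K).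
  apply: uniq_perm; rewrite ?enum_uniq //.
    by rewrite /= rcons_uniq enum_uniq !(mem_rcons, mem_enum, inE) !eqxx (negPf ab).
  move=> x; rewrite !(inE, mem_rcons, mem_enum).
  by case: (eqVneq x a) => [->|] //=; case: (eqVneq x b) => [->|].
have Uq : uniq (a :: q) by rewrite (perm_uniq qE) enum_uniq.
exists (a :: q ++ p); split.
- rewrite /ucycle /ucycleb -cat_cons cat_uniq Uq Up andbT /=; apply/andP; split.
    rewrite rcons_cat cat_path last_rcons bpa andbT.
    apply: (sorted_clique Uq) => x y; rewrite !(perm_mem qE) !mem_enum.
    exact: Kc.
  apply/hasPn=> x /pK; apply: contraNN => /= xq.
  by rewrite -mem_enum -(perm_mem qE).
- move=> x; rewrite -cat_cons !mem_cat (perm_mem qE) orbC //.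
- by rewrite -cat_cons size_cat (perm_size qE) -cardE.
Qed.


Lemma long_cycle_or_two_cliques e A t : symmetric e -> irreflexive e ->
  6 * t + 5 <= #|A| -> (t + 2) * (t + 3) <= 2 * #|A| ->
  defect e A <= 2 * (t * (#|A| - t.+1)) ->
  (exists s, [/\ ucycle e s, {subset s <= A} & #|A| - t < size s]) \/
  (exists u C, two_cliques e A u C /\ #|C| = t).
Proof.
move=> e_sym e_irr; elim: t A => [|t IH] A n6 nt defA.
  (* Without missing edges [A] is a clique: the degenerate case of an empty [C], with any vertex as
     [u]. *)
  right; have /card_gt0P[u uA] : 0 < #|A| by lia.
  exists u, set0; rewrite cards0; split=> //; split; rewrite ?sub0set ?inE //.
  move=> x y xA yA xy; rewrite !inE /=.
  by apply: (@defect_eq0 _ A) => //; lia.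
have [/forall_inP degA|] := boolP [forall x in A, t.+1 < deg e A x].
  left; have [s [Cs sA sz]] := erdos_hamiltonian e_sym e_irr n6 nt degA defA.
  by exists s; split=> //; rewrite sz; lia.
rewrite negb_forall_in => /exists_inP[v vA]; rewrite -leqNgt => deg_v.
have EA : #|A| = (#|A :\ v|).+1 by rewrite (cardsD1 v) vA.
have co_v := deg_codeg e_irr vA.
have Edef := defect_setD1 e_sym vA.
have [a Ea] : {a | #|A| = t + 2 + a} by exists (#|A| - (t + 2)); lia.
(* A vertex of degree at most [t.+1] misses at least [#|A| - t.+2] others, exactly the drop of the
   bound from [t.+1] to [t]. *)
have def_v : 2 * (t.+1 * (#|A| - t.+2)) =
    2 * (t * (#|A :\ v| - t.+1)) + 2 * (#|A| - t.+2).
  have -> : #|A :\ v| - t.+1 = a by lia.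
  have -> : #|A| - t.+2 = a by lia.
  by lia.
have [|||[s [Cs sA sz]]|[u [C [TC EC]]]] := IH (A :\ v); [lia|lia|lia| |].
  left; exists s; split=> //; last lia.
  by move=> x /sA; rewrite inE => /andP[].
have := two_cliques_defect e_sym TC; rewrite EC => lb.
have [uA CA uC eE] := TC.
(* The two cliques already use up the defect allowed in [A :\ v], so [v] misses at most
   [#|A| - t.+2] vertices. *)
have {lb} deg_v1 : t < deg e A v by lia.
have {n6 Ea a def_v} tA : t.+1 < #|A| by lia.
clear nt defA deg_v Edef co_v.
have vC : v \notin C by apply/negP=> /(subsetP CA); rewrite !inE eqxx.
have uv : u != v by move: uA; rewrite !inE => /andP[].
pose K := (A :\ v) :\: C.
have cardK : #|K| = #|A| - t.+1 by rewrite cardsD (setIidPr CA) EC; lia.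
have Kc : {in K &, forall x y, x != y -> e x y}.
  move=> x y; rewrite !inE => /and3P[xC xv xA] /and3P[yC yv yA] xy.
  by rewrite eE ?inE ?xv ?yv ?xA ?yA // xC yC.
have vK : v \notin K by rewrite !inE eqxx andbF.
have uK : u \in K by rewrite inE uC.
have KA : K \subset A by apply/subsetP=> x; rewrite !inE => /and3P[].
pose Nv := [set y in A | e v y].
have Nsplit : #|Nv| = #|Nv :&: K| + #|Nv :&: C|.
  rewrite -(cardsID C Nv) addnC; congr (_ + _); apply: eq_card => y.
  rewrite !inE; case: (eqVneq y v) => [->|_] /=; first by rewrite e_irr !andbF.
  by case: (y \in A); rewrite /= ?andbT ?andbF // andbC.
have NC : #|Nv :&: C| <= t by rewrite -EC subset_leq_card // subsetIr.
(* Two neighbours of [v] in the large clique [K] make [v] an ear. Otherwise the degree of [v] forces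
   exactly one neighbour [w] in [K] and all of [C]. *)
have [/card_gt1P[x [y [xN yN xy]]]|N1] := boolP (1 < #|Nv :&: K|).
  left; case/setIP: xN yN; rewrite inE => /andP[_ evx] xK /setIP[].
  rewrite inE => /andP[_ evy] yK.
  have [|||s [Cs sK sz]] := @clique_path_cycle e K [:: v] x y Kc xK yK xy.
  - by [].
  - by move=> z; rewrite inE => /eqP ->.
  - by rewrite /= e_sym evy evx.
  exists s; split=> //; last by rewrite sz cardK addn1.
  move=> z /sK; rewrite mem_cat mem_enum inE => /orP[/eqP ->//|]; exact: (subsetP KA).
have [w wE] : exists w, Nv :&: K = [set w].
  apply/cards1P; move: deg_v1 N1; rewrite /deg -/Nv Nsplit; clear - NC; lia.
have CN : C \subset Nv.
  apply/setIidPr/eqP; rewrite eqEcard subsetIr EC.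
  by move: deg_v1; rewrite /deg -/Nv Nsplit wE cards1.
have [evw wK] : e v w /\ w \in K.
  by have := set11 w; rewrite -wE => /setIP[]; rewrite inE => /andP[_ ->].
have evE x : x \in A -> e v x = (x == w) || (x \in C).
  move=> xA; apply/idP/orP=> [evx|[/eqP ->//|/(subsetP CN)]]; last by rewrite inE => /andP[].
  have [xC|xC] := boolP (x \in C); [by right|left].
  rewrite -in_set1 -wE !inE xA evx xC /= andbT.
  by apply: contraTneq evx => ->; rewrite e_irr.
(* If [w = u], then [v] enlarges the small clique. If [C] is empty, [v] is pendant at [w], the new
   cut vertex. *)
have [uwC|] := boolP ((u == w) || (C == set0)).
  right; exists w, (v |: C); split; last by rewrite cardsU1 vC EC.
  have [wC wv wA] : [/\ w \notin C, w != v & w \in A].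
    by move: wK; rewrite !inE => /and3P[].
  split=> //.
  - by rewrite subUset sub1set vA (subset_trans CA) // subsetDl.
  - by rewrite !inE negb_or wv.
  move=> x y xA yA xy.
  have [xv|xv] := eqVneq x v.
    move: xy; rewrite xv => xy.
    by rewrite evE // !inE eqxx orbT /= [y == v]eq_sym (negPf xy).
  have [yv|yv] := eqVneq y v.
    by rewrite yv e_sym evE // !inE eqxx orbT (negPf xv) /= andbF andbT.
  rewrite eE ?in_setD1 ?xv ?yv // !in_setU1 (negPf xv) (negPf yv) /=.
  by case/orP: uwC => /eqP ->; rewrite ?in_set0.
(* Otherwise [c] and [v] form an ear on [K] from [u] to [w]. *)
rewrite negb_or => /andP[uw /set0Pn[c cC]]; left.
have cA := subsetP CA c cC.
have [||||s [Cs sK sz]] := @clique_path_cycle e K [:: c; v] w u Kc wK uK.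
- by rewrite eq_sym.
- by rewrite /= inE andbT; apply: contraNneq vC => <-.
- by move=> z; rewrite !inE => /orP[] /eqP ->; rewrite ?cC // eqxx andbF.
- rewrite /= evw andbT; apply/andP; split.
    rewrite eE //; last by apply: contraNneq uC => ->.
    by rewrite !inE eqxx cC !orbT.
  by rewrite e_sym evE ?cC ?orbT //; move: cA; rewrite inE => /andP[].
exists s; split=> //; last by rewrite sz cardK addn2 ltnS leqW.
move=> z /sK; rewrite mem_cat mem_enum !inE => /orP[/orP[] /eqP ->//|/and3P[]//].
by move: cA; rewrite inE => /andP[].
Qed.

End LongCycle.

(** * Edge counts, cycle lengths and the extremal graph *)

Section SimpleGraphs.

Variable G : sgraph.

(** Each edge comes from two ordered adjacent pairs, distinct by irreflexivity. *)
Lemma edges_le_degree_sum :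
  2 * #|edges G| <= \sum_(x in [set: G]) deg (@adj G) [set: G] x.
Proof.
have -> : \sum_(x in [set: G]) deg (@adj G) [set: G] x =
    \sum_(p : G * G | adj p.1 p.2) 1.
  rewrite -(pair_big_dep xpredT (@adj G) (fun _ _ => 1)) /=.
  apply: eq_big => [x|x _]; first by rewrite inE.
  by rewrite sum1dep_card; apply: eq_card => y; rewrite !inE.
rewrite (partition_big_imset (fun p : G * G => [set p.1; p.2])) /=.
rewrite -[leqLHS]mulnC -sum_nat_const [leqRHS](eq_bigl (mem (edges G))) /=; last first.
  by move=> E; apply/imsetP/imsetP => -[p Pp ->]; exists p; rewrite ?inE in Pp *.
apply: leq_sum => E /imsetP[[x y]]; rewrite inE /= => exy ->.
have xy : (x, y) != (y, x) :> G * G.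
  by apply: contraTneq exy => -[-> _]; rewrite adj_irr.
rewrite sum1dep_card; have <- : #|[set (x, y); (y, x)]| = 2 by rewrite cards2 xy.
apply: subset_leq_card; apply/subsetP=> p.
rewrite !inE unfold_in => /orP[] /eqP -> /=; first by rewrite exy eqxx.
by rewrite adj_sym exy setUC eqxx.
Qed.

Lemma double_bin2 m : 2 * 'C(m, 2) = m * m.-1.
Proof. by case: m => // m; rewrite -mul_bin_diag bin1. Qed.

Lemma sum_deg_defect (e : rel G) (A : {set G}) : irreflexive e ->
  \sum_(x in A) deg e A x + defect e A + #|A| = #|A| * #|A|.
Proof.
move=> e_irr; rewrite -sum1_card /defect -!big_split /= sum1_card -sum_nat_const.
by apply: eq_bigr => x xA; rewrite addn1 deg_codeg.
Qed.

(** A decidable form, from which a maximal length can be extracted. *)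
Definition has_cycleb l := (2 < l) && [exists s : l.-tuple G, ucycleb (@adj G) s].

Lemma has_cycleP l : reflect (has_cycle G l) (has_cycleb l).
Proof.
apply: (iffP andP) => -[l2]; last first.
  move=> [s [sz Cs]]; split=> //; apply/existsP.
  by move/eqP: sz => sz; exists (Tuple sz).
by move=> /existsP[s Cs]; split=> //; exists s; rewrite size_tuple.
Qed.

Lemma has_cycle_le_card l : has_cycle G l -> l <= #|G|.
Proof.
by move=> [_ [s [<- /andP[_ /card_uniqP <-]]]]; apply: max_card.
Qed.

Lemma circumference_exists l : has_cycle G l -> exists c, is_circumference G c.
Proof.
move=> Cl; have exl : exists i, has_cycleb i by exists l; apply/has_cycleP.
have ub i : has_cycleb i -> i <= #|G| by move=> /has_cycleP /has_cycle_le_card.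
case: (ex_maxnP exl ub) => c /has_cycleP Cc max_c; exists c; split=> // i.
by move=> /has_cycleP /max_c.
Qed.

(** On the vertices of the cycle the degree sum is at least [c * c - c - D], more than half of
    [c * c], as Bondy's argument requires. *)
Lemma cycle_lengths_below (c l D : nat) :
  defect (@adj G) [set: G] <= D -> 2 * D + 2 * c < c * c ->
  has_cycle G c -> 2 < l <= c -> has_cycle G l.
Proof.
move=> defG Dc [c2 [s [sz Cs]]] lc.
pose S := [set x in s].
have Us : uniq s by case/andP: Cs.
have sS : s =i S by move=> x; rewrite inE.
have cS : #|S| = c by rewrite -sz -(card_uniqP Us); apply: eq_card => x; rewrite inE.
have Es : \sum_(x <- s) count (adj x) s = \sum_(x in S) deg (@adj G) S x.
  rewrite big_uniq //; apply: eq_big => x; rewrite ?inE // => _.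
  exact: count_deg.
have [||s' [sz' Cs']] := @bondy_pancyclic _ (@adj G) (@adj_sym G) s l (@adj_irr G) Cs.
- rewrite sz Es; have := sum_deg_defect S (@adj_irr G).
  have := defect_sub (@adj G) (subsetT S); rewrite cS; clear - defG Dc; lia.
- by rewrite sz.
- by split; [case/andP: lc | exists s'].
Qed.

Lemma two_cliques_isomorphic u (C : {set G}) :
  two_cliques (@adj G) [set: G] u C -> isomorphic G (Lgraph #|G| #|C|).
Proof.
move=> [_ _ uC eE].
pose B := ~: (u |: C).
have cB : #|B| = #|G| - #|C| - 1.
  by have := cardsC (u |: C); rewrite cardsU1 uC /B /=; lia.
have cGC : #|C| < #|G|.
  by have := max_card [in u |: C]; rewrite cardsU1 uC.
(* The map starts from the extremal graph, where the constructors tell the cut vertex, [B] and [C]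
   apart; [gC] and [gu] then reduce adjacency to cases. *)
pose g (a : Lgraph #|G| #|C|) : G := match a with
  | inl _ => u
  | inr (inl i) => nth u (enum B) i
  | inr (inr i) => nth u (enum C) i
  end.
have gC a : g a \in C = if a is inr (inr _) then true else false.
  case: a => [_|[i|i]] /=; first exact/negbTE.
    apply/negbTE; have : nth u (enum B) i \in enum B.
      by rewrite mem_nth // -cardE cB.
    by rewrite mem_enum !inE negb_or => /andP[].
  by rewrite -mem_enum mem_nth // -cardE.
have gu a : (g a == u) = if a is inl _ then true else false.
  case: a => [_|[i|i]] /=; first exact: eqxx.
    apply/negbTE; have : nth u (enum B) i \in enum B.
      by rewrite mem_nth // -cardE cB.
    by rewrite mem_enum !inE negb_or => /andP[].
  apply: contraNF uC => /eqP <-.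
  by rewrite -mem_enum mem_nth // -cardE.
have g_inj : injective g.
  move=> a b gab; have := gu a; have := gC a; rewrite gab gC gu.
  case: a b gab => [i|[i|i]] [j|[j|j]] //=; first by rewrite (ord1 i) (ord1 j).
    move/eqP; rewrite nth_uniq ?enum_uniq -?cardE ?cB // => /eqP ij _ _.
    by congr (inr (inl _)); apply: val_inj.
  move/eqP; rewrite nth_uniq ?enum_uniq -?cardE // => /eqP ij _ _.
  by congr (inr (inr _)); apply: val_inj.
have [f gK fK] : bijective g.
  apply: inj_card_bij => //.
  by rewrite !card_sum !card_ord; lia.
have gE a b : adj (g a) (g b) = adj a b.
  have [->|ab] := eqVneq a b; first by rewrite !adj_irr.
  rewrite eE ?inE // ?(inj_eq g_inj) // !gC !gu.
  by case: a b ab => [i|[i|i]] [j|[j|j]].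
exists f; split; first by exists g.
by move=> x y; rewrite -gE !fK.
Qed.

End SimpleGraphs.

Theorem theorem2p1 (k n : nat) (G : sgraph)
  (hG : #|G| = n)
  (hn : maxn (6 * k + 11) (((k + 3) * (k + 4)) %/ 2) <= n)
  (he : 'C(n - k - 1, 2) + 'C(k + 2, 2) <= #|edges G|) :
  (weakly_pancyclic G /\ is_girth G 3) /\
  ((forall l : nat, 3 <= l <= n - k -> has_cycle G l) \/
   isomorphic G (Lgraph n (k + 1))).
Proof.
have [n6 nk] : 6 * k + 11 <= n /\ (k + 3) * (k + 4) <= 2 * n.
  move: hn; rewrite geq_max => /andP[-> nk]; split=> //.
  (* The product is even, so the integer division is exact. *)
  have : 2 %| (k + 3) * (k + 4).
    by rewrite dvdn2 oddM !oddD /=; case: (odd k).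
  by move=> /divnK <-; rewrite mulnC leq_mul2l.
have cT : #|[set: G]| = n by rewrite cardsT.
(* Twice the number of pairs between [K_{n-k-2}] and [K_{k+1}] in the extremal graph. *)
have defG : defect (@adj G) [set: G] <= 2 * (k.+1 * (n - k.+2)).
  have := sum_deg_defect [set: G] (@adj_irr G); rewrite cT.
  have := edges_le_degree_sum G.
  have := double_bin2 (n - k - 1); have := double_bin2 (k + 2).
  have [b Eb] : {b | n = b + k + 2} by exists (n - (k + 2)); clear - n6; lia.
  have -> : n - k - 1 = b.+1 by clear - Eb; lia.
  have -> : n - k.+2 = b by clear - Eb; lia.
  move: he; have -> : n - k - 1 = b.+1 by clear - Eb; lia.
  by rewrite Eb addn2 /=; clear; lia.
have below c l : n - k.+1 <= c -> has_cycle G c -> 2 < l <= c -> has_cycle G l.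
  move=> nc; apply: (cycle_lengths_below defG).
  have [b Eb] : {b | n = b + 6 * k + 11} by exists (n - (6 * k + 11)); clear - n6; lia.
  have [d Ed] : {d | c = 5 * k + 10 + b + d}.
    by exists (c - (5 * k + 10 + b)); clear - nc Eb; lia.
  have -> : n - k.+2 = 5 * k + 9 + b by clear - Eb; lia.
  by rewrite Ed; clear; lia.
(* The circumference is at least [c], so [below] gives every length from 3 up to it. *)
have wp c : n - k.+1 <= c -> has_cycle G c ->
    (weakly_pancyclic G /\ is_girth G 3).
  move=> nc Cc; have [d [Cd max_d]] := circumference_exists Cc.
  have nd : n - k.+1 <= d := leq_trans nc (max_d c Cc).
  have d3 : 2 < d by case: Cd.
  have G3 : is_girth G 3.
    by split=> [|l []//]; apply: (below d).
  split=> //; exists 3, d; split=> // l; exact: below.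
(* For [t = k + 1] the two order conditions become [6 * k + 11 <= n] and
   [(k + 3) * (k + 4) <= 2 * n]. *)
have [|||[s [Cs _ sz]]|[u [C [TC EC]]]] :=
    @long_cycle_or_two_cliques _ (@adj G) [set: G] k.+1 (@adj_sym G) (@adj_irr G).
- by rewrite cT; clear - n6; lia.
- by rewrite cT; clear - nk; lia.
- by rewrite cT.
- have Cc : has_cycle G (size s).
    by split; [move: sz; rewrite cT; clear - n6; lia | exists s].
  rewrite cT in sz; split; first by apply: wp Cc; apply: ltnW.
  left=> l /andP[l3 ln]; apply: (below (size s)) => //; first exact: ltnW.
  by rewrite l3; move: sz ln; clear - n6; lia.
- have [_ _ uC eE] := TC.
  (* The large clique with its cut vertex has a spanning cycle, just long enough for [wp]. *)
  have cK : #|~: C| = n - k.+1.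
    by have := cardsC C; rewrite EC hG; clear; lia.
  split; last by right; rewrite -hG addn1 -EC; apply: two_cliques_isomorphic TC.
  apply: (wp (n - k.+1)) => //; split; first by clear - n6; lia.
  exists (enum (~: C)); rewrite -cardE cK; split=> //.
  rewrite /ucycle /ucycleb enum_uniq andbT.
  apply: clique_cycle; [exact: enum_uniq| |].
    by rewrite -cardE cK; clear - n6; lia.
  by move=> x y; rewrite !mem_enum !inE => xC yC xy; rewrite eE ?inE // xC yC.
Qed.
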